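(* For all integers $n\ge1$ and $m\ge0$, the number of simple $(n,m)$-$(R,\vec r)$-graphs is $$SG_{R,\vec r}(n,m)=[w^m]\sum_{\{\vec n\in\mathbb N^q\,:\,n_1+\cdots+n_q=n\}}\binom n{\vec n}\,\vec r^{\;\vec n}\prod_{1\le i<j\le q}(1+R_{i,j}w)^{n_in_j}\prod_{i=1}^q(1+R_{i,i}w)^{n_i(n_i-1)/2}.$$
   Context: Fix $q\ge 1$, a symmetric irreducible $q\times q$ matrix $R=(R_{i,j})$ and a vector $\vec r=(r_1,\dots,r_q)^T$, both with non-negative real entries. $\vec r^{\;\vec n}=\prod_i r_i^{n_i}$; $\binom{n}{\vec n}=n!/\prod_i n_i!$ when $\sum_i n_i=n$; $[w^m]$ extracts the coefficient of $w^m$. A simple $(R,\vec r)$-graph is a labelled graph on vertex set $\{1,\dots,n\}$ with neither loops nor multiple edges, in which each vertex $v$ is given a type $t(v)\in\{1,\dots,q\}$; its weight is $\omega(G)=\prod_{u}r_{t(u)}\prod_{\overline{vw}}R_{t(v),t(w)}$ (products over the vertices and the edges). The ''number'' of such graphs in a family is the sum of their weights; a simple $(n,m)$-$(R,\vec r)$-graph has $n$ vertices and $m$ edges. *)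

(* Defs.v *)
From mathcomp Require Import all_boot all_order all_fingroup all_algebra.
From mathcomp Require Import reals.

Set Implicit Arguments.
Unset Strict Implicit.
Unset Printing Implicit Defensive.

Import Order.TTheory GRing.Theory Num.Theory.
Local Open Scope ring_scope.

Section Irreducible.
Variables (K : realType) (q : nat).

(* A is reducible when a simultaneous permutation of its rows and columns is
   block upper triangular, with two square diagonal blocks of positive sizes
   k and q - k. In particular every 1 x 1 matrix, zero included, is
   irreducible. *)
Definition reducible_mx (A : 'M[K]_q) : Prop :=
  exists (s : 'S_q) (k : nat), (0 < k < q)%N /\
    forall i j : 'I_q, (k <= i)%N -> (j < k)%N ->
      col_perm s (row_perm s A) i j = 0.

Definition irreducible_mx (A : 'M[K]_q) : Prop := ~ reducible_mx A.

End Irreducible.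

(* The vertices 1, ..., n and the types 1, ..., q are renumbered from 0. The
   first component assigns the types; the second one is the set of edges, an
   edge being a set of exactly two vertices, so that neither loops nor multiple
   edges occur. *)
Definition sgraph (q n : nat) :=
  {g : {ffun 'I_n -> 'I_q} * {set {set 'I_n}}
     | [forall e in g.2, #|e| == 2%N]}.

Definition vtype q n (G : sgraph q n) : {ffun 'I_n -> 'I_q} := (val G).1.
Definition edges q n (G : sgraph q n) : {set {set 'I_n}} := (val G).2.

Section Counting.
Variables (K : realType) (q : nat) (R : 'M[K]_q) (r : 'cV[K]_q).

(* Each edge {v, w} is listed once, as its pair of endpoints v < w; the order
   is irrelevant when R is symmetric. *)
Definition weight n (G : sgraph q n) : K :=
  (\prod_(u < n) r (vtype G u) 0) *
  (\prod_(v < n) \prod_(w < n | (v < w)%N && ([set v; w] \in edges G))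
     R (vtype G v) (vtype G w)).

Definition number n (F : pred (sgraph q n)) : K :=
  \sum_(G : sgraph q n | F G) weight G.

Definition SG (n m : nat) : K :=
  number [pred G : sgraph q n | #|edges G| == m].

End Counting.

(* Main.v *)
Require Import Defs.
From mathcomp Require Import all_boot all_order all_fingroup all_algebra.
From mathcomp Require Import reals.

Set Implicit Arguments.
Unset Strict Implicit.
Unset Printing Implicit Defensive.

Import Order.TTheory GRing.Theory Num.Theory.
Local Open Scope ring_scope.

(** Fix the types t of the vertices. The graphs with these types are the subsets
    of the set of all pairs {v, w}, and the variable 'X records the number of
    chosen pairs: expanding the product of the 1 + R (t v) (t w) *: 'X over all
    pairs gives one term per edge set, so the coefficient of 'X^m is the total
    edge weight of the graphs with m edges (SG_sum_types, which rests on
    coef_prod_1DX).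

    As R is symmetric, the factor of a pair depends only on the unordered pair
    of types of its endpoints. If n_i vertices have type i, then n_i * n_j pairs
    have the types {i, j} when i <> j, and n_i * (n_i - 1) / 2 pairs have both
    endpoints of type i; hence the product depends on t only through the vector
    of the n_i (prod_pairs_fibre_card). The same holds for the vertex weights
    (prod_fibre_card).

    It remains to group the type assignments t by this vector. A vector with sum
    n arises from n! / \prod_i n_i! of them (card_ffun_fibre_card): listing the
    values of t turns the assignments into the rearrangements of a fixed word in
    which each letter i occurs n_i times. *)

(** * The multinomial count of functions with given fibre sizes *)

Definition fibre_card (aT rT : finType) (t : aT -> rT) (i : rT) : nat :=
  #|[set v | t v == i]|.

Lemma sum_count_mem (T : finType) (s : seq T) :
  (\sum_(x : T) count_mem x s)%N = size s.
Proof.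
elim: s => [|y s IHs] /=; first by rewrite big1.
rewrite big_split /= IHs (bigD1 y) //= eqxx big1 ?addn0 // => x.
by rewrite eq_sym => /negPf->.
Qed.

(** Induction on the length: a rearrangement of s begins with a letter x of s and
    continues with a rearrangement of s minus x. Removing x divides the product
    of the factorials by the multiplicity of x, so after multiplication the
    letters x contribute their multiplicities times (n - 1)!, and these
    multiplicities add up to n. *)
Lemma size_permutations_multinomial (T : finType) (s : seq T) :
  (size (permutations s) * \prod_(x : T) (count_mem x s)`!)%N = (size s)`!.
Proof.
move Dn: (size s) => n; elim: n s Dn => [|n IHn] s Dn.
  by rewrite (size0nil Dn) /= big1.
rewrite (perm_size (permutationsE _)) ?Dn // size_allpairs_dep sumnE big_map.
rewrite big_uniq ?undup_uniq // (eq_bigl (mem s)) => [|x]; last first.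
  exact: mem_undup.
rewrite big_distrl factS -Dn -sum_count_mem big_distrl big_mkcond /=.
apply: eq_bigr => x _; case: ifPn => [sx|/count_memPn->]; last by rewrite mul0n.
rewrite -(IHn (rem x s)) ?size_rem ?Dn // mulnCA; congr (_ * _)%N.
rewrite (bigD1 x) // [in RHS](bigD1 x) //= mulnA; congr (_ * _)%N.
  rewrite count_mem_rem eqxx subn1.
  by move: sx; rewrite -has_pred1 has_count; case: (count_mem x s).
by apply: eq_bigr => y /negPf ne_yx; rewrite count_mem_rem eq_sym ne_yx subn0.
Qed.

Lemma count_mem_codom (aT rT : finType) (t : aT -> rT) (i : rT) :
  count_mem i (codom t) = fibre_card t i.
Proof.
rewrite /codom count_map /fibre_card cardE -size_filter /enum_mem.
rewrite -filter_predI; congr (size _); apply: eq_filter => v.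
by rewrite /= !inE ?andbT.
Qed.

(** The list of values of a function determines it, and the functions with fibre
    sizes a are exactly those whose list of values rearranges a fixed word s with
    a i occurrences of i. Stated as a product to stay within the naturals. *)
Lemma card_ffun_fibre_card (aT rT : finType) (a : rT -> nat) :
    (\sum_i a i)%N = #|aT| ->
  (#|[set t : {ffun aT -> rT} | [forall i, fibre_card t i == a i]]|
     * \prod_i (a i)`!)%N = #|aT|`!.
Proof.
move=> sum_a.
pose s := flatten [seq nseq (a i) i | i <- enum rT].
have count_s i : count_mem i s = a i.
  rewrite count_flatten -map_comp sumnE big_map big_enum /= (bigD1 i) //=.
  rewrite count_nseq /= eqxx mul1n big1 ?addn0 // => j ne_ji.
  by rewrite count_nseq /= (negPf ne_ji).
have size_s : size s = #|aT|.
  by rewrite -sum_count_mem -sum_a; apply: eq_bigr => i _.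
rewrite -size_s -size_permutations_multinomial; congr (_ * _)%N; last first.
  by apply: eq_bigr => i _; rewrite count_s.
pose cod (t : {ffun aT -> rT}) : seq rT := fgraph t.
rewrite cardE -(size_map cod); apply/perm_size/uniq_perm.
- by rewrite map_inj_uniq ?enum_uniq // => t1 t2 /val_inj/(can_inj fgraphK).
- exact: permutations_uniq.
move=> u; rewrite mem_permutations; apply/mapP/idP => [[t] | eq_us].
  rewrite mem_enum inE => /forallP/= a_t ->; apply/allP => i _ /=.
  by rewrite count_s -(eqP (a_t i)) -count_mem_codom.
have size_u : size u == #|aT| by rewrite (perm_size eq_us) size_s.
exists (Finfun (Tuple size_u)); last by rewrite /cod FinfunK.
rewrite mem_enum inE; apply/forallP => i; rewrite -count_mem_codom codom_ffun.
by rewrite FinfunK /= -count_s; exact/eqP/seq.permP.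
Qed.

(** * Unordered pairs of vertices *)

(** A copy of the 2-subsets of A, each listed in increasing order; this is the
    form in which edges appear in weights and in double products over v < w. *)
Definition upairs n (A : {set 'I_n}) : {set 'I_n * 'I_n} :=
  [set p : 'I_n * 'I_n | [&& (p.1 < p.2)%N, p.1 \in A & p.2 \in A]].

Lemma upair_inj n :
  {in [pred p : 'I_n * 'I_n | (p.1 < p.2)%N] &,
     injective (fun p : 'I_n * 'I_n => [set p.1; p.2])}.
Proof.
move=> [v w] [v' w']; rewrite !inE /= => lt_vw lt_vw' eq_p.
have: v \in [set v'; w'] by rewrite -eq_p set21.
have: w \in [set v'; w'] by rewrite -eq_p set22.
rewrite !inE => /orP[] /eqP Dw /orP[] /eqP Dv; subst => //.
- by rewrite ltnn in lt_vw.
- by have := ltn_trans lt_vw lt_vw'; rewrite ltnn.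
- by rewrite ltnn in lt_vw.
Qed.

Lemma imset_upairs n (A : {set 'I_n}) :
  (fun p : 'I_n * 'I_n => [set p.1; p.2]) @: upairs A =
  [set e : {set 'I_n} | e \subset A & #|e| == 2%N].
Proof.
apply/setP => e; rewrite inE; apply/imsetP/andP.
  move=> [[v w]]; rewrite !inE /= => /and3P[lt_vw Av Aw] ->.
  by rewrite subUset !sub1set Av Aw cards2 -val_eqE neq_ltn lt_vw.
move=> [sub_e /cards2P[v [w [ne_vw De]]]].
have [Av Aw] : v \in A /\ w \in A.
  by apply/andP; rewrite -!sub1set -subUset -De.
case: (ltngtP v w) => [lt_vw|lt_wv|/val_inj Evw]; last first.
- by rewrite Evw eqxx in ne_vw.
- by exists (w, v); rewrite ?inE ?lt_wv ?Av ?Aw //= setUC.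
- by exists (v, w); rewrite ?inE ?lt_vw ?Av.
Qed.

Lemma card_upairs n (A : {set 'I_n}) : #|upairs A| = (#|A| * #|A|.-1)./2.
Proof.
rewrite -bin2 -cards_draws -imset_upairs card_in_imset // => p p'.
by rewrite !inE => /andP[lt_p _] /andP[lt_p' _]; apply: upair_inj.
Qed.

(** * Edge sets and the generating polynomial *)

(** Choosing from each factor either 1 or the linear term amounts to choosing a
    subset B of A, and the choice contributes in degree #|B|. *)
Lemma coef_prod_1DX (S : comNzRingType) (T : finType) (A : {set T}) (c : T -> S)
    (m : nat) :
  (\prod_(i in A) (1 + c i *: 'X))`_m =
  \sum_(B : {set T} | (B \subset A) && (#|B| == m)) \prod_(i in B) c i.
Proof.
(* Extending c by 0 outside A makes the product range over the whole type; the
   subsets that leave A then contribute 0. *)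
pose d i := if i \in A then c i else 0.
have -> : \prod_(i in A) (1 + c i *: 'X) = \prod_i (d i *: 'X + 1).
  rewrite big_mkcond; apply: eq_bigr => i _; rewrite /d addrC.
  by case: ifP => // _; rewrite scale0r add0r.
rewrite bigA_distr coef_sum [RHS]big_mkcond /=; apply: eq_bigr => B _.
rewrite -big_mkcond /= scaler_prod prodr_const coefZ coefXn.
rewrite [m == _]eq_sym; case: (#|B| == m); rewrite ?andbF ?mulr0 // andbT mulr1.
case: ifPn => [/subsetP subBA|/subsetPn[i Bi A'i]].
  by apply: eq_bigr => i /subBA Ai; rewrite /d Ai.
by rewrite (bigD1 i) //= /d (negPf A'i) mul0r.
Qed.

(** The subset expansion, transported along the bijection between sets of
    increasing pairs and sets of edges. *)
Lemma sum_edge_sets (S : comNzRingType) n m (c : 'I_n * 'I_n -> S) :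
  \sum_(E : {set {set 'I_n}} | [forall e in E, #|e| == 2%N] && (#|E| == m))
     \prod_(p : 'I_n * 'I_n | (p.1 < p.2)%N && ([set p.1; p.2] \in E)) c p =
  (\prod_(p : 'I_n * 'I_n | (p.1 < p.2)%N) (1 + c p *: 'X))`_m.
Proof.
pose h (p : 'I_n * 'I_n) := [set p.1; p.2].
pose U := upairs [set: 'I_n].
have inU p : (p \in U) = (p.1 < p.2)%N by rewrite !inE !andbT.
have h_inj : {in U &, injective h}.
  by move=> p p'; rewrite !inU; apply: upair_inj.
have hU e : (e \in h @: U) = (#|e| == 2%N).
  by rewrite imset_upairs inE subsetT.
rewrite -(eq_bigl _ _ inU) coef_prod_1DX.
rewrite (reindex_onto (fun B : {set _} => h @: B)
           (fun E : {set _} => U :&: h @^-1: E)) /=; last first.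
  move=> E /andP[/forall_inP E2 _]; apply/setP => e.
  apply/imsetP/idP => [[p] | Ee]; first by rewrite !inE => /andP[_ Ep] ->.
  have := E2 e Ee; rewrite -hU => /imsetP[p Up De].
  by exists p; rewrite // inE Up inE -De.
apply: eq_big => [B | B /andP[_ /eqP DB]].
  apply/andP/andP => [[/andP[_ card_hB] /eqP DB] | [sBU card_B]].
    have sBU : B \subset U by rewrite -DB subsetIl.
    move: card_hB; rewrite card_in_imset //.
    by apply: sub_in2 h_inj; apply/subsetP.
  have h_injB : {in B &, injective h} by apply: sub_in2 h_inj; apply/subsetP.
  rewrite card_in_imset // card_B andbT; split.
    apply/forall_inP => _ /imsetP[p /(subsetP sBU) Up ->].
    by rewrite -hU imset_f.
  apply/eqP/setP => p; rewrite in_setI [X in _ && X]inE.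
  apply/andP/idP => [[Up /imsetP[p' Bp' /h_inj Dp]] | Bp].
    by rewrite Dp // (subsetP sBU).
  by rewrite (subsetP sBU) // imset_f.
by apply: eq_bigl => p; rewrite -[in RHS]DB in_setI inU inE.
Qed.

(** * Products that depend only on the fibre sizes *)

Lemma prod_fibre_card (S : comNzRingType) (aT rT : finType) (t : aT -> rT)
    (f : rT -> S) :
  \prod_v f (t v) = \prod_i f i ^+ fibre_card t i.
Proof.
rewrite (partition_big t predT) //=; apply: eq_bigr => i _.
rewrite -prodr_const; apply: eq_big => [v | v /eqP->] //.
by rewrite inE.
Qed.

(** Among the increasing pairs of vertices, those with equal types are counted
    type by type, by card_upairs. Those with distinct types may be decreasing in
    type; symmetry of F allows each of these to be swapped, after which one has
    all ordered pairs of vertices with increasing types, and the pairs with types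
    i < j form the product of two fibres. *)
Lemma prod_pairs_fibre_card (S : comNzRingType) n q (t : 'I_n -> 'I_q)
    (F : 'I_q -> 'I_q -> S) (F_sym : forall i j, F i j = F j i) :
  \prod_(p : 'I_n * 'I_n | (p.1 < p.2)%N) F (t p.1) (t p.2) =
  (\prod_(i < q) \prod_(j < q | (i < j)%N)
     F i j ^+ (fibre_card t i * fibre_card t j)) *
  \prod_i F i i ^+ (fibre_card t i * (fibre_card t i).-1)./2.
Proof.
pose H (p : 'I_n * 'I_n) := F (t p.1) (t p.2).
rewrite (bigID (fun p : 'I_n * 'I_n => t p.1 != t p.2)) /=; congr (_ * _).
  transitivity (\prod_(p | (t p.1 < t p.2)%N) H p).
    rewrite (bigID (fun p : 'I_n * 'I_n => (t p.1 < t p.2)%N)) /=.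
    rewrite [RHS](bigID (fun p : 'I_n * 'I_n => (p.1 < p.2)%N)) /=.
    congr (_ * _).
      apply: eq_bigl => p; rewrite -val_eqE /=.
      by case: (ltngtP (t p.1) (t p.2)); rewrite ?andbF ?andbT.
    (* What remains are the pairs increasing in vertex but decreasing in type;
       swapped, they are the pairs increasing in type but not in vertex. *)
    rewrite (reindex_inj (can_inj swap_pairK)) /=.
    apply: eq_big => [[v w] | [v w] _] /=; last exact: F_sym.
    rewrite -val_eqE.
    case: (ltngtP v w) => [lt_vw|lt_wv|/val_inj->]; rewrite ?andbF //=.
      by case: ltngtP.
    by rewrite ltnn.
  rewrite pair_big_dep /=.
  rewrite (partition_big (fun p : 'I_n * 'I_n => (t p.1, t p.2))
             (fun ij : 'I_q * 'I_q => (ij.1 < ij.2)%N)) //=.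
  apply: eq_bigr => -[i j] /= lt_ij; rewrite /fibre_card -cardsX -prodr_const.
  apply: eq_big => [[v w] | [v w] /andP[_ /eqP[<- <-]]] //=.
  rewrite !inE xpair_eqE /= andb_idl // => /andP[/eqP-> /eqP->]; exact: lt_ij.
rewrite (partition_big (fun p : 'I_n * 'I_n => t p.1) predT) //=.
apply: eq_bigr => i _.
rewrite -card_upairs -prodr_const; apply: eq_big => [p | p].
  rewrite !inE -andbA negbK; congr andb; rewrite andbC.
  by case: eqP => [->|//]; rewrite eq_sym.
by rewrite -andbA negbK => /and3P[_ /eqP<- /eqP->].
Qed.

(** * Graphs with given types *)

(** Being simple constrains the edge set alone, so the sum over graphs splits into
    a sum over types and, inside it, a sum over edge sets; the vertex weight is
    constant on the latter, and sum_edge_sets evaluates what is left. *)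
Lemma SG_sum_types (K : realType) q (R : 'M[K]_q) (r : 'cV[K]_q) n m :
  SG R r n m =
  \sum_(t : {ffun 'I_n -> 'I_q}) (\prod_u r (t u) 0) *
    (\prod_(p : 'I_n * 'I_n | (p.1 < p.2)%N)
        (1 + R (t p.1) (t p.2) *: 'X))`_m.
Proof.
pose simple (E : {set {set 'I_n}}) := [forall e in E, #|e| == 2%N].
pose w (t : {ffun 'I_n -> 'I_q}) (E : {set {set 'I_n}}) : K :=
  (\prod_u r (t u) 0) *
  \prod_(p : 'I_n * 'I_n | (p.1 < p.2)%N && ([set p.1; p.2] \in E))
     R (t p.1) (t p.2).
transitivity (\sum_(t : {ffun 'I_n -> 'I_q})
                 \sum_(E | simple E && (#|E| == m)) w t E).
  rewrite pair_big_dep /=.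
  rewrite (reindex_omap (val : sgraph q n -> _) insub) /=; last first.
    by move=> g /andP[simple_g _]; rewrite insubT.
  apply: eq_big => [G | G _] /=.
    have simple_G : simple (val G).2 := valP G.
    by rewrite valK eqxx andbT simple_G.
  by rewrite /weight pair_big_dep.
by apply: eq_bigr => t _; rewrite -big_distrr /= sum_edge_sets.
Qed.

Theorem theorem13 (K : realType) (q : nat) (hq : (1 <= q)%N)
    (R : 'M[K]_q) (r : 'cV[K]_q)
    (R_sym : R^T = R) (R_irr : irreducible_mx R)
    (R_ge0 : forall i j, 0 <= R i j) (r_ge0 : forall i, 0 <= r i 0)
    (n m : nat) (hn : (1 <= n)%N) :
  SG R r n m =
  (\sum_(a : {ffun 'I_q -> 'I_n.+1} | (\sum_(i < q) a i)%N == n)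
     (n`!%:R / \prod_(i < q) (a i)`!%:R * \prod_(i < q) r i 0 ^+ a i) *:
       ((\prod_(i < q) \prod_(j < q | (i < j)%N)
           (1 + R i j *: 'X) ^+ (a i * a j)) *
        \prod_(i < q) (1 + R i i *: 'X) ^+ (a i * (a i).-1)./2))`_m.
Proof.
have fibre_lt (t : {ffun 'I_n -> 'I_q}) i : (fibre_card t i < n.+1)%N.
  by rewrite ltnS -[leqRHS](card_ord n) max_card.
pose profile (t : {ffun 'I_n -> 'I_q}) : {ffun 'I_q -> 'I_n.+1} :=
  [ffun i => Ordinal (fibre_lt t i)].
have profile_sum t : (\sum_(i < q) profile t i)%N == n.
  rewrite -[X in _ == X](card_ord n) -(size_codom t) -sum_count_mem.
  by apply/eqP/eq_bigr => i _; rewrite count_mem_codom ffunE.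
rewrite SG_sum_types coef_sum.
rewrite (partition_big profile (fun a => (\sum_(i < q) a i)%N == n)) //=.
apply: eq_bigr => a /eqP sum_a; rewrite coefZ.
have -> : n`!%:R / \prod_(i < q) (a i)`!%:R =
          #|[set t : {ffun 'I_n -> 'I_q} | profile t == a]|%:R :> K.
  have := @card_ffun_fibre_card 'I_n 'I_q (fun i => a i).
  rewrite card_ord => /(_ sum_a) <-; rewrite natrM natr_prod mulfK; last first.
    by apply/prodf_neq0 => i _; rewrite pnatr_eq0 -lt0n fact_gt0.
  congr (_%:R); apply: eq_card => t; rewrite !inE.
  apply/forallP/eqP => [t_a | <- i]; last by rewrite ffunE.
  by apply/ffunP => i; rewrite ffunE; apply/val_inj/eqP/t_a.
rewrite -mulrA mulr_natl -sumr_const; apply: eq_big => [t | t /eqP Da].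
  by rewrite inE.
have a_t i : a i = fibre_card t i :> nat by rewrite -Da ffunE.
rewrite (prod_fibre_card t (fun i => r i 0)).
rewrite (prod_pairs_fibre_card t (F := fun i j => 1 + R i j *: 'X)) => [|i j].
  congr (_ * (_ : {poly K})`_m); first by apply: eq_bigr => i _; rewrite a_t.
  congr (_ * _); last by apply: eq_bigr => i _; rewrite a_t.
  by apply: eq_bigr => i _; apply: eq_bigr => j _; rewrite !a_t.
by rewrite -[in LHS]R_sym mxE.
Qed.
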